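(* Let $F$ be the free group on the 26 letters $a,b,c,\dots,z$ of the alphabet, and let $G$ be the quotient of $F$ by the relations $A=B$, one for every pair of words $A$ and $B$ of the German language whose pronunciations agree. Then the group $G$ is trivial.
   Context: A written word is regarded as an element of the free group $F$ by multiplying its letters in the order in which they are written; capitalization is ignored. ''Agreement'' of pronunciations (homophony) is determined by standard dictionaries of German (the Duden). In particular, $G$ is the quotient of $F$ by the normal closure of all elements $AB^{-1}$ with $A,B$ homophonic German words (including loanwords assimilated into German). Pronunciation data: the full set of homophonic pairs is that of the German language; the following pairs are among those that count as homophonic (so each gives one of the defining relations of $G$): Waage/wage, Wahl/Wal, Meer/mehr, Boot/bot, hohle/hole, Bug/buk, Alb/Alp, Mann/man, viel/fiel, wage/vage, hallt/Halt, gewallt/Gewalt, starrt/Start, schafft/Schaft, klappst/klapst, schnippst/schnipst, fasst/fast, Zittern/Zithern, Stadt/statt, hemmt/Hemd, packt/Pakt, Kitz/Kitts, lax/Lachs, klipp/Clip, tschau/ciao, roien/reuen, beaten/bieten, Toy/toi, Bayer/Baier, Yoghurt/Joghurt, Clique/klicke, Q/Kuh. *)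

(* Defs.v *)
From HB Require Import structures.
From Stdlib Require Import String Ascii.
From mathcomp Require Import all_boot.
From mathcomp Require Import boolp classical_sets.

Set Implicit Arguments.
Unset Strict Implicit.
Unset Printing Implicit Defensive.

Local Open Scope group_scope.
Local Open Scope quotient_scope.
Local Open Scope classical_set_scope.

Section FreeGroup.
Variable A : choiceType.

(* (a, false) stands for the generator a and (a, true) for its inverse. *)
Definition slot : Type := (A * bool)%type.
Definition flip (x : slot) : slot := (x.1, ~~ x.2).

Definition reduced (w : seq slot) : bool := sorted (fun x y => y != flip x) w.

Definition rcancel (x : slot) (w : seq slot) : seq slot :=
  if w is y :: w' then if y == flip x then w' else x :: w else [:: x].

Definition reduce (w : seq slot) : seq slot := foldr rcancel [::] w.

Lemma flipK : involutive flip.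
Proof. by case=> a b; rewrite /flip /= negbK. Qed.

Lemma reduced_rcancel x w : reduced w -> reduced (rcancel x w).
Proof.
case: w => [|y w] //= yw; case: eqP => [_|/eqP ney]; first exact: path_sorted yw.
by rewrite /reduced /= ney.
Qed.

Lemma reduced_reduce w : reduced (reduce w).
Proof. by elim: w => //= x w; apply: reduced_rcancel. Qed.

Lemma reduce_id w : reduced w -> reduce w = w.
Proof.
elim: w => //= x w IH xw; rewrite IH; last exact: path_sorted xw.
by case: w xw {IH} => //= y w /andP[/negPf->].
Qed.

Lemma rcancelK x w : reduced w -> rcancel x (rcancel (flip x) w) = w.
Proof.
case: w => [|y w] /=; first by rewrite eqxx.
rewrite flipK; case: (y =P x) => [->|_ _] /=; last by rewrite eqxx.
by case: w => //= z w /andP[/negPf->].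
Qed.

Lemma foldr_rcancel x w s : reduced s ->
  foldr rcancel s (rcancel x w) = rcancel x (foldr rcancel s w).
Proof.
move=> rs; case: w => //= y w; case: eqP => //= ->.
rewrite rcancelK //; elim: w => //= z w; exact: reduced_rcancel.
Qed.

Lemma foldr_reduce w s : reduced s ->
  foldr rcancel s (reduce w) = foldr rcancel s w.
Proof. by move=> rs; elim: w => //= x w IH; rewrite foldr_rcancel // IH. Qed.

Lemma reduce_cat u v : reduce (u ++ v) = foldr rcancel (reduce v) u.
Proof. by rewrite /reduce foldr_cat. Qed.

Lemma reduce_catl u v : reduce (reduce u ++ v) = reduce (u ++ v).
Proof. by rewrite !reduce_cat foldr_reduce // reduced_reduce. Qed.

Lemma reduce_catr u v : reduce (u ++ reduce v) = reduce (u ++ v).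
Proof. by rewrite !reduce_cat (reduce_id (reduced_reduce v)). Qed.

Definition word_inv (w : seq slot) : seq slot := rev (map flip w).

Lemma word_invK : involutive word_inv.
Proof. by move=> w; rewrite /word_inv map_rev revK (mapK flipK). Qed.

Lemma reduce_mulV w : reduce (w ++ word_inv w) = [::].
Proof.
elim: w => //= x w IH.
rewrite /word_inv /= rev_cons -cats1 catA -/(word_inv w) -reduce_catl IH /=.
by rewrite eqxx.
Qed.

Record freeGroup := FreeGroup { fgval :> seq slot; _ : reduced fgval }.

HB.instance Definition _ := [isSub for fgval].
HB.instance Definition _ := [Choice of freeGroup by <:].

Definition mkfree (w : seq slot) : freeGroup := FreeGroup (reduced_reduce w).

Definition fg_one : freeGroup := mkfree [::].
Definition fg_mul (u v : freeGroup) : freeGroup := mkfree (u ++ v).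
Definition fg_inv (u : freeGroup) : freeGroup := mkfree (word_inv u).

Fact fg_mulA : associative fg_mul.
Proof.
by move=> u v w; apply: val_inj => /=; rewrite reduce_catr reduce_catl catA.
Qed.

Fact fg_mul1 : left_id fg_one fg_mul.
Proof. by move=> [u ru]; apply: val_inj; rewrite /= reduce_id. Qed.

Fact fg_mulr1 : right_id fg_one fg_mul.
Proof. by move=> [u ru]; apply: val_inj; rewrite /= cats0 reduce_id. Qed.

Fact fg_mulV : left_inverse fg_one fg_inv fg_mul.
Proof.
move=> u; apply: val_inj; rewrite /= reduce_catl.
by rewrite -{2}[fgval u]word_invK reduce_mulV.
Qed.

Fact fg_mulrV : right_inverse fg_one fg_inv fg_mul.
Proof. by move=> u; apply: val_inj; rewrite /= reduce_catr reduce_mulV. Qed.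

HB.instance Definition _ :=
  isGroup.Build freeGroup fg_mulA fg_mul1 fg_mulr1 fg_mulV fg_mulrV.

Definition fgen (a : A) : freeGroup := mkfree [:: (a, false)].

End FreeGroup.

Section NormalQuotient.
Variable T : groupType.

Definition is_normal_subgroup (N : set T) : Prop :=
  [/\ N 1, forall x y, N x -> N y -> N (x / y) & forall x y, N x -> N (x ^ y)].

Record normalSubgroup :=
  NormalSubgroup { nset : set T; nsetP : is_normal_subgroup nset }.

Definition normal_closure_set (S : set T) : set T :=
  [set x | forall N : set T, is_normal_subgroup N -> S `<=` N -> N x].

Fact normal_closure_normal S : is_normal_subgroup (normal_closure_set S).
Proof.
split=> [N nN _|x y Nx Ny N nN SN|x y Nx N nN SN]; case: (nN) => N1 ND NJ //.
- by apply: ND; [apply: Nx | apply: Ny].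
- by apply: NJ; apply: Nx.
Qed.

Definition normal_closure (S : set T) : normalSubgroup :=
  NormalSubgroup (normal_closure_normal S).

Variable N : normalSubgroup.

Definition same_coset (x y : T) : bool := `[< nset N (x / y) >].

Let N1 : nset N 1. Proof. by case: (nsetP N). Qed.
Let ND x y : nset N x -> nset N y -> nset N (x / y). Proof. by case: (nsetP N) => _ + _; apply. Qed.
Let NJ x y : nset N x -> nset N (x ^ y). Proof. by case: (nsetP N) => _ _; apply. Qed.
Let NV x : nset N x -> nset N x^-1. Proof. by move=> /(ND N1); rewrite mul1g. Qed.
Let NM x y : nset N x -> nset N y -> nset N (x * y).
Proof. by move=> Nx /NV Ny; rewrite -[y]invgK; apply: ND. Qed.

Fact same_coset_equiv : equiv_class_of same_coset.
Proof.
split=> [x|x y|y x z].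
- by apply/asboolP; rewrite mulgV.
- by apply/asboolP/asboolP => /NV; rewrite invgF.
- move=> /asboolP xy /asboolP yz; apply/asboolP.
  by have := NM xy yz; rewrite mulgA mulgVK.
Qed.

Canonical same_coset_rel := EquivRelPack same_coset_equiv.

Definition quotientGroup : Type := {eq_quot same_coset}.

HB.instance Definition _ := Choice.on quotientGroup.
HB.instance Definition _ := EqQuotient.on quotientGroup.

Definition coset_of_elt (x : T) : quotientGroup := \pi_({eq_quot same_coset}) x.

Lemma coset_eqP x y : coset_of_elt x = coset_of_elt y <-> nset N (x / y).
Proof.
by split=> [/eqmodP/asboolP//|Nxy]; apply/eqmodP/asboolP.
Qed.

Definition q_one : quotientGroup := coset_of_elt 1.
Definition q_mul (u v : quotientGroup) : quotientGroup :=
  coset_of_elt (repr u * repr v).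
Definition q_inv (u : quotientGroup) : quotientGroup := coset_of_elt (repr u)^-1.

Lemma coset_surj u : exists x, u = coset_of_elt x.
Proof. by exists (repr u); rewrite /coset_of_elt reprK. Qed.

Lemma repr_coset x : nset N (repr (coset_of_elt x) / x).
Proof. by apply/coset_eqP; rewrite /coset_of_elt reprK. Qed.

Lemma coset_mul x y : q_mul (coset_of_elt x) (coset_of_elt y) = coset_of_elt (x * y).
Proof.
apply/coset_eqP; set x' := repr _; set y' := repr _.
have Nx : nset N (x' / x) := repr_coset x; have Ny : nset N (y' / y) := repr_coset y.
have := NM Nx (NJ x^-1 Ny).
by rewrite /conjg invgK invgM !mulgA mulgVK.
Qed.

Lemma coset_inv x : q_inv (coset_of_elt x) = coset_of_elt x^-1.
Proof.
apply/coset_eqP; rewrite invgK; set x' := repr _.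
have Nx : nset N (x' / x) := repr_coset x.
by have := NJ x' (NV Nx); rewrite /conjg invgF !mulgA mulgVK.
Qed.

Fact q_mulA : associative q_mul.
Proof.
move=> u v w; have [x ->] := coset_surj u; have [y ->] := coset_surj v.
by have [z ->] := coset_surj w; rewrite !coset_mul mulgA.
Qed.

Fact q_mul1 : left_id q_one q_mul.
Proof. by move=> u; have [x ->] := coset_surj u; rewrite coset_mul mul1g. Qed.

Fact q_mulr1 : right_id q_one q_mul.
Proof. by move=> u; have [x ->] := coset_surj u; rewrite coset_mul mulg1. Qed.

Fact q_mulV : left_inverse q_one q_inv q_mul.
Proof.
by move=> u; have [x ->] := coset_surj u; rewrite coset_inv coset_mul mulVg.
Qed.

Fact q_mulrV : right_inverse q_one q_inv q_mul.
Proof.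
by move=> u; have [x ->] := coset_surj u; rewrite coset_inv coset_mul mulgV.
Qed.

HB.instance Definition _ :=
  isGroup.Build quotientGroup q_mulA q_mul1 q_mulr1 q_mulV q_mulrV.

End NormalQuotient.

(* The letters a, ..., z are numbered 0, ..., 25. *)
Notation letter := 'I_26.

Definition letter_of (c : ascii) : option letter :=
  let n := nat_of_ascii c in
  if (97 <= n <= 122)%N then Some (inord (n - 97))
  else if (65 <= n <= 90)%N then Some (inord (n - 65))
  else None.

(* Words containing an umlaut, a sharp s, a hyphen, an apostrophe or a space  *)
(* are not products of the 26 generators and contribute no relation.          *)
Definition in_alphabet (w : string) : bool :=
  all (fun c => letter_of c != None) (list_ascii_of_string w).

Definition F : groupType := freeGroup letter.

Definition word_elt (w : string) : F :=
  \prod_(x <- pmap letter_of (list_ascii_of_string w)) fgen x.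

(* A language consists of its written words and of the pronunciations each of *)
(* them admits; heteronyms have several.                                      *)
Record language := Language {
  is_word : string -> Prop;
  pronunciation : Type;
  pronounced : string -> pronunciation -> Prop
}.

Definition homophonic (L : language) (A B : string) : Prop :=
  [/\ is_word L A, is_word L B &
      exists p : pronunciation L, pronounced A p /\ pronounced B p].

Definition homophony_relators (L : language) : set F :=
  [set g | exists A B, [/\ in_alphabet A, in_alphabet B, homophonic L A B
                         & g = word_elt A / word_elt B]].

Definition homophony_group (L : language) : groupType :=
  quotientGroup (normal_closure (homophony_relators L)).

(* The vocabulary and pronunciation of German are empirical data; these are   *)
(* the homophonic pairs of German that are recorded explicitly.               *)
Definition listed_homophones : seq (string * string) :=
 ([:: ("Waage", "wage"); ("Wahl", "Wal"); ("Meer", "mehr"); ("Boot", "bot");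
      ("hohle", "hole"); ("Bug", "buk"); ("Alb", "Alp"); ("Mann", "man");
      ("viel", "fiel"); ("wage", "vage"); ("hallt", "Halt");
      ("gewallt", "Gewalt"); ("starrt", "Start"); ("schafft", "Schaft");
      ("klappst", "klapst"); ("schnippst", "schnipst"); ("fasst", "fast");
      ("Zittern", "Zithern"); ("Stadt", "statt"); ("hemmt", "Hemd");
      ("packt", "Pakt"); ("Kitz", "Kitts"); ("lax", "Lachs");
      ("klipp", "Clip"); ("tschau", "ciao"); ("roien", "reuen");
      ("beaten", "bieten"); ("Toy", "toi"); ("Bayer", "Baier");
      ("Yoghurt", "Joghurt"); ("Clique", "klicke"); ("Q", "Kuh")])%string.

(* Main.v *)
From HB Require Import structures.
From Stdlib Require Import String Ascii.
From mathcomp Require Import all_boot.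
From mathcomp Require Import boolp classical_sets.
Require Import Defs.

(** Each pair of homophones is an equation between two words in the images of
    the letters, and in any group these equations can be solved one letter at a
    time. A pair that differs by doubling a letter, or by a mute letter, makes
    that letter trivial (Waage/wage gives a = 1, Wahl/Wal gives h = 1); a pair
    that differs by exchanging a letter identifies two letters (Bug/buk gives
    g = k). Once enough letters are trivial, the pairs with quite different
    spellings collapse to equations in one or two letters: tschau/ciao becomes
    u = i and beaten/bieten becomes 1 = i. This elimination, carried out in
    [letters_trivial] for an arbitrary group, reaches all 26 letters. It is then
    applied to the quotient group, where the equations hold by construction, and
    [morph_fgen_trivial] passes from the generators to the whole group. *)

Local Open Scope string_scope.
Local Open Scope group_scope.

Lemma mulg_idr_eq1 (H : groupType) (u v : H) : u * v = u -> v = 1.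
Proof. by move=> uv; apply: (mulgI u); rewrite mulg1. Qed.

Lemma morph_fgen_trivial (A : choiceType) (H : groupType)
    (phi : freeGroup A -> H) :
  {morph phi : u v / u * v} -> (forall a, phi (fgen a) = 1) ->
  forall u, phi u = 1.
Proof.
move=> phiM phi_gen.
have phi1 : phi 1 = 1 by apply: (@mulg_idr_eq1 _ (phi 1)); rewrite -phiM mulg1.
have phi_slot s : phi (mkfree [:: s]) = 1.
  case: s => a [|]; last exact: phi_gen.
  have -> : mkfree [:: (a, true)] = (fgen a)^-1 by exact: val_inj.
  by rewrite -[LHS]mul1g -{1}(phi_gen a) -phiM mulgV.
move=> u; have -> : u = mkfree u.
  by apply: val_inj; rewrite /= reduce_id //; case: u.
elim: (fgval u) => [|s w IH]; first exact: phi1.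
have -> : mkfree (s :: w) = mkfree [:: s] * mkfree w.
  by apply: val_inj; rewrite -[RHS]/(reduce (reduce [:: s] ++ reduce w))
    reduce_catl reduce_catr.
by rewrite phiM phi_slot IH mulg1.
Qed.

Definition spell (H : groupType) (x : letter -> H) (w : string) : H :=
  \prod_(i <- pmap letter_of (list_ascii_of_string w)) x i.

(** The letter with a given number is built by [inord], which does not reduce,
    so the evaluation of a concrete word is done on numbers. *)
Definition letter_code (c : ascii) : option nat :=
  let n := nat_of_ascii c in
  if (97 <= n <= 122)%N then Some (n - 97)%N
  else if (65 <= n <= 90)%N then Some (n - 65)%N
  else None.

(** A left-nested product without a leading 1, so that the value of a concrete
    word is convertible to the product as one writes it. *)
Definition spell_code (H : groupType) (y : nat -> H) (w : string) : H :=
  if pmap letter_code (list_ascii_of_string w) is n :: s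
  then foldl (fun g k => g * y k) (y n) s else 1.

Lemma letter_ofE c : letter_of c = omap inord (letter_code c).
Proof. by rewrite /letter_of /letter_code; case: ifP => // _; case: ifP. Qed.

Lemma spellE (H : groupType) (x : letter -> H) w :
  spell H x w = spell_code H (fun n => x (inord n)) w.
Proof.
rewrite /spell /spell_code.
have -> : pmap letter_of (list_ascii_of_string w) =
          map inord (pmap letter_code (list_ascii_of_string w)).
  elim: (list_ascii_of_string w) => //= c s ->.
  by rewrite letter_ofE; case: letter_code.
case: (pmap _ _) => [|n s]; first by rewrite big_nil.
rewrite big_map big_cons; elim: s (x _) => [|k s IH] g /=.
  by rewrite big_nil mulg1.
by rewrite big_cons mulgA IH.
Qed.

Local Ltac listed E A B := apply: (E A B); do ?[by left | right].

(** The order of elimination matters: after cancelling common prefixes and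
    suffixes, a pair is used once all but one of the remaining letters are known
    to be trivial. *)
Lemma letters_trivial (H : groupType) (x : letter -> H) :
  (forall A B, List.In (A, B) listed_homophones -> spell H x A = spell H x B) ->
  forall i, x i = 1.
Proof.
move=> homE; pose y n := x (inord n).
have codeE A B : List.In (A, B) listed_homophones ->
    spell_code H y A = spell_code H y B.
  by move=> /homE; rewrite !spellE.
pose a := y 0; pose b := y 1%N; pose c := y 2; pose d := y 3; pose e := y 4.
pose f := y 5; pose g := y 6; pose h := y 7; pose i := y 8; pose j := y 9.
pose k := y 10; pose l := y 11; pose m := y 12; pose n := y 13; pose o := y 14.
pose p := y 15; pose q := y 16; pose r := y 17; pose s := y 18; pose t := y 19.
pose u := y 20; pose v := y 21; pose w := y 22; pose x' := y 23.
pose y' := y 24; pose z := y 25.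
have Waage : w * a * a * g * e = w * a * g * e by listed codeE "Waage" "wage".
have Wahl : w * a * h * l = w * a * l by listed codeE "Wahl" "Wal".
have Meer : m * e * e * r = m * e * h * r by listed codeE "Meer" "mehr".
have Boot : b * o * o * t = b * o * t by listed codeE "Boot" "bot".
have Bug : b * u * g = b * u * k by listed codeE "Bug" "buk".
have Alb : a * l * b = a * l * p by listed codeE "Alb" "Alp".
have Mann : m * a * n * n = m * a * n by listed codeE "Mann" "man".
have viel : v * i * e * l = f * i * e * l by listed codeE "viel" "fiel".
have wage : w * a * g * e = v * a * g * e by listed codeE "wage" "vage".
have hallt : h * a * l * l * t = h * a * l * t by listed codeE "hallt" "Halt".
have starrt : s * t * a * r * r * t = s * t * a * r * t
  by listed codeE "starrt" "Start".
have schafft : s * c * h * a * f * f * t = s * c * h * a * f * t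
  by listed codeE "schafft" "Schaft".
have klappst : k * l * a * p * p * s * t = k * l * a * p * s * t
  by listed codeE "klappst" "klapst".
have fasst : f * a * s * s * t = f * a * s * t by listed codeE "fasst" "fast".
have Zittern : z * i * t * t * e * r * n = z * i * t * h * e * r * n
  by listed codeE "Zittern" "Zithern".
have Stadt : s * t * a * d * t = s * t * a * t * t
  by listed codeE "Stadt" "statt".
have hemmt : h * e * m * m * t = h * e * m * d by listed codeE "hemmt" "Hemd".
have packt : p * a * c * k * t = p * a * k * t by listed codeE "packt" "Pakt".
have Kitz : k * i * t * z = k * i * t * t * s by listed codeE "Kitz" "Kitts".
have lax : l * a * x' = l * a * c * h * s by listed codeE "lax" "Lachs".
have klipp : k * l * i * p * p = c * l * i * p by listed codeE "klipp" "Clip".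
have tschau : t * s * c * h * a * u = c * i * a * o
  by listed codeE "tschau" "ciao".
have beaten : b * e * a * t * e * n = b * i * e * t * e * n
  by listed codeE "beaten" "bieten".
have Toy : t * o * y' = t * o * i by listed codeE "Toy" "toi".
have Yoghurt : y' * o * g * h * u * r * t = j * o * g * h * u * r * t
  by listed codeE "Yoghurt" "Joghurt".
have Q : q = k * u * h by listed codeE "Q" "Kuh".
have a1 : a = 1 by move: Waage => /mulIg/mulIg/mulg_idr_eq1.
have h1 : h = 1 by move: Wahl => /mulIg/mulg_idr_eq1.
have e1 : e = 1 by move: Meer => /mulIg/mulgI ->.
have o1 : o = 1 by move: Boot => /mulIg/mulg_idr_eq1.
have n1 : n = 1 by move: Mann => /mulg_idr_eq1.
have l1 : l = 1 by move: hallt => /mulIg/mulg_idr_eq1.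
have r1 : r = 1 by move: starrt => /mulIg/mulg_idr_eq1.
have f1 : f = 1 by move: schafft => /mulIg/mulg_idr_eq1.
have v1 : v = 1 by move: viel => /mulIg/mulIg/mulIg ->.
have w1 : w = 1 by move: wage => /mulIg/mulIg/mulIg ->.
have p1 : p = 1 by move: klappst => /mulIg/mulIg/mulg_idr_eq1.
have b1 : b = 1 by move: Alb => /mulgI ->.
have s1 : s = 1 by move: fasst => /mulIg/mulg_idr_eq1.
have t1 : t = 1 by move: Zittern => /mulIg/mulIg/mulIg/mulgI ->.
have d1 : d = 1 by move: Stadt => /mulIg/mulgI ->.
have m1 : m = 1 by move: hemmt; rewrite d1 t1 !mulg1 => /mulg_idr_eq1.
have c1 : c = 1 by move: packt => /mulIg/mulIg/mulg_idr_eq1.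
have z1 : z = 1 by move: Kitz; rewrite t1 s1 !mulg1 => /mulg_idr_eq1.
have x1 : x' = 1 by move: lax; rewrite c1 h1 s1 !mulg1 => /mulg_idr_eq1.
have k1 : k = 1 by move: klipp; rewrite p1 !mulg1 => /mulIg/mulIg ->.
have g1 : g = 1 by move: Bug => /mulgI ->.
have i1 : i = 1.
  by move: beaten; rewrite b1 e1 a1 t1 n1 !mulg1 mul1g => <-.
have u1 : u = 1.
  by move: tschau; rewrite t1 s1 c1 h1 a1 o1 i1 !mulg1 mul1g.
have y1 : y' = 1 by move: Toy => /mulgI ->.
have j1 : j = 1 by move: Yoghurt => /mulIg/mulIg/mulIg/mulIg/mulIg/mulIg <-.
have q1 : q = 1 by rewrite Q k1 u1 h1 !mulg1.
move=> l0; rewrite -[l0]inord_val -/(y _).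
by case: l0 => N /=; do 26 (case: N => [//|N]).
Qed.

Theorem theorem1 (German : language)
  (hGerman : forall A B : string,
     List.In (A, B) listed_homophones -> homophonic German A B) :
  forall g : homophony_group German, g = 1.
Proof.
pose N := normal_closure (homophony_relators German).
pose phi : F -> homophony_group German := @coset_of_elt F N.
have phiM : {morph phi : u v / u * v}.
  by move=> u v; rewrite /phi -[LHS]coset_mul.
have phi_word w : phi (word_elt w) = spell _ (fun i => phi (fgen i)) w.
  exact: (big_morph phi phiM (erefl (phi 1))).
have phi_gen : forall i, phi (fgen i) = 1.
  apply: letters_trivial => A B AB.
  rewrite -!phi_word; apply/coset_eqP => M _; apply.
  (* A pair gives a relation only if both words avoid umlauts and the like,
     which is checked here by evaluating the listed words. *)
  have /List.Forall_forall inF : List.Forall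
    (fun X => in_alphabet X.1 && in_alphabet X.2) listed_homophones.
    have inE w : in_alphabet w =
        all (fun c => letter_code c != None) (list_ascii_of_string w).
      by apply: eq_all => c; rewrite letter_ofE; case: letter_code.
    by rewrite /listed_homophones; do ?[constructor; first by rewrite !inE].
  have /andP[inA inB] := inF _ AB.
  by exists A, B; split=> //; apply: hGerman.
by move=> g; have [w ->] := coset_surj g; apply: (morph_fgen_trivial _ _ phi).
Qed.
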